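(* Let $m\ge 1$ and $k\ge 1$ be integers. For $A\in V=Mat(m\times m^2;F)$ let $q_{A,k}$ be the quadratic form on $F^{m^k}$ given by the $m^k\times m^k$ matrix $\tilde{Tr}((A^{\overline{t}}A)^{\overline{\otimes} k})$, i.e. $q_{A,k}(x)=x^t\,\tilde{Tr}((A^{\overline{t}}A)^{\overline{\otimes} k})\,x$. Then every invariant of quadratic forms, evaluated at $q_{A,k}$, is an invariant of $m$-dimensional algebras. That is, if $f$ is an $F$-valued function on the set of quadratic forms on $F^{m^k}$ such that $f(q\circ h)=f(q)$ for all quadratic forms $q$ and all $h\in GL(m^k,F)$, then $f(q_{\tau(g,A),k})=f(q_{A,k})$ for all $A\in V$ and all $g\in GL(m,F)$.
   Context: $F$ is a field of characteristic not $2$. For matrices over $F$, $\otimes$ is the Kronecker product: $A\otimes B$ is the block matrix $(a_{ij}B)$. An $m$-dimensional algebra over $F$ with a fixed basis $e=(e_1,\dots,e_m)$ is identified with its matrix of structure constants $A=(A^i_{jk})\in V=Mat(m\times m^2;F)$, where $e_j\cdot e_k=\sum_i A^i_{jk}e_i$ (row index $i$; columns indexed by the pairs $(j,k)$ in lexicographic order). The group $GL(m,F)$ acts on $V$ by $\tau(g,A)=gA(g^{-1}\otimes g^{-1})$ (change of basis). An invariant of $m$-dimensional algebras is a function on $V$ that is invariant under $\tau$. Write $A=(A_1,\dots,A_m)$ with $A_j\in Mat(m,F)$ the consecutive $m\times m$ blocks, i.e. $A_j=(A^i_{jk})_{i,k}$. For block matrices with blocks in $Mat(m,F)$, an overlined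 operation is carried out over the ring $Mat(m,F)$, treating blocks as entries. Thus $A^{\overline{t}}$ is the block column with blocks $A_1,\dots,A_m$ (the blocks themselves are not transposed), and $A^{\overline{t}}A$ is the $m\times m$ block matrix whose $(i,j)$ block is $A_iA_j$. For block matrices $M=(M_{ab})$ and $N=(N_{cd})$, $M\overline{\otimes}N$ is the block matrix whose block at row $(a,c)$, column $(b,d)$ (lexicographic order) is the product $M_{ab}N_{cd}$, and $M^{\overline{\otimes}k}$ is the $k$-fold product $M\overline{\otimes}\cdots\overline{\otimes}M$. Finally, $\tilde{Tr}$ denotes block-wise application of the trace: $\tilde{Tr}((M_{ab}))=(Tr(M_{ab}))$. *)

(* Defs.v *)
From HB Require Import structures.
From mathcomp Require Import all_boot all_algebra.
From mathcomp Require Import mxtens.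

Set Implicit Arguments.
Unset Strict Implicit.
Unset Printing Implicit Defensive.

Import GRing.Theory.
Local Open Scope ring_scope.

Section Algebras.

Variables (F : fieldType) (m : nat).

(* A : 'M[F]_(m, m * m) is a matrix of structure constants: with
   mxtens_index (j, k) = j * m + k the lexicographic position of the pair
   (j, k), e_j . e_k = \sum_i A i (mxtens_index (j, k)) e_i. *)
Definition alg_action (g : 'M[F]_m) (A : 'M[F]_(m, m * m)) :
    'M[F]_(m, m * m) :=
  g *m A *m tensmx (invmx g) (invmx g).

Definition alg_invariant (I : 'M[F]_(m, m * m) -> F) : Prop :=
  forall (g : 'M[F]_m) (A : 'M[F]_(m, m * m)),
    g \in unitmx -> I (alg_action g A) = I A.

Definition alg_block (A : 'M[F]_(m, m * m)) (j : 'I_m) : 'M[F]_m :=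
  \matrix_(i, k) A i (mxtens_index (j, k)).

(* A block matrix with blocks in Mat(m, F) is a matrix over the ring
   'M[F]_m. The overlined operations are then the ordinary operations of the
   outer matrix: trmx leaves the blocks untransposed, mulmx multiplies them
   as ring elements, and tensmx, ntensmx do so in the given order. *)
Definition alg_row (A : 'M[F]_(m, m * m)) : 'rV['M[F]_m]_m :=
  \row_j alg_block A j.

Definition alg_gram (A : 'M[F]_(m, m * m)) : 'M['M[F]_m]_m :=
  (alg_row A)^T *m alg_row A.

Definition block_trace p q (M : 'M['M[F]_m]_(p, q)) : 'M[F]_(p, q) :=
  map_mx (@mxtrace F m) M.

(* ntensmx M k is the k-fold tensor power; its value at k = 0 is the 1 x 1
   identity. *)
Definition alg_form_mx (A : 'M[F]_(m, m * m)) (k : nat) : 'M[F]_(m ^ k) :=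
  block_trace (ntensmx (alg_gram A) k).

End Algebras.

Section QuadraticForms.

Variables (F : fieldType) (n : nat).

Definition mx_qf (Q : 'M[F]_n) (x : 'cV[F]_n) : F := (x^T *m Q *m x) 0 0.

(* Quadratic forms are functions on F^n: different matrices may define the
   same form, and the matrix is not required to be symmetric. *)
Definition is_quadratic_form (q : 'cV[F]_n -> F) : Prop :=
  exists Q : 'M[F]_n, forall x, q x = mx_qf Q x.

Record quadratic_form := QuadraticForm {
  qf_fun :> 'cV[F]_n -> F;
  qf_funP : is_quadratic_form qf_fun
}.

Lemma mx_qfP (Q : 'M[F]_n) : is_quadratic_form (mx_qf Q).
Proof. by exists Q. Qed.

Definition qf_of_mx (Q : 'M[F]_n) : quadratic_form := QuadraticForm (mx_qfP Q).

Lemma qf_compP (q : quadratic_form) (h : 'M[F]_n) :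
  is_quadratic_form (fun x => q (h *m x)).
Proof.
have [Q qE] := qf_funP q; exists (h^T *m Q *m h) => x.
by rewrite qE /mx_qf trmx_mul !mulmxA.
Qed.

Definition qf_comp (q : quadratic_form) (h : 'M[F]_n) : quadratic_form :=
  QuadraticForm (qf_compP q h).

Definition qf_invariant (f : quadratic_form -> F) : Prop :=
  forall (q : quadratic_form) (h : 'M[F]_n),
    h \in unitmx -> f (qf_comp q h) = f q.

End QuadraticForms.

Definition alg_qf (F : fieldType) (m k : nat) (A : 'M[F]_(m, m * m)) :
    quadratic_form F (m ^ k) :=
  qf_of_mx (alg_form_mx A k).

(* Main.v *)
Require Import Defs.
From HB Require Import structures.
From mathcomp Require Import all_boot all_algebra mxtens.
From mathcomp Require Import boolp.

(** Put h = g^-1. Expanding [gA(h (x) h)] one factor at a time, the j-th block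
    of the transformed algebra is g (sum_a h_aj A_a) h: the blocks are recombined
    by the columns of h, then conjugated by g. Read over the ring of m x m
    matrices, with H the matrix of scalar blocks h_aj, the block row becomes
    g (A H) h, the conjugation being applied to each block
    ([alg_row_action]).

    Scalar blocks are central, so the usual rules for transposes of products
    and for tensor products of products hold for factors like H, although the
    ring of blocks is not commutative. Conjugation is a ring morphism, so it
    commutes with products and tensor products over the ring of blocks. Hence
    the k-th tensor power of the Gram matrix of the transformed algebra is the
    conjugate of K^T M K, where M is the k-th tensor power of the Gram matrix of
    A and K consists of the scalar blocks of the k-th tensor power of h. The
    trace is linear and blind to conjugation, so after taking traces this says
    that the matrix of the form undergoes a congruence by an invertible matrix
    over F ([alg_form_mx_action]); the form itself is thus changed by a linear
    substitution, which invariants of quadratic forms do not see. *)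

Set Implicit Arguments.
Unset Strict Implicit.
Unset Printing Implicit Defensive.

Import GRing.Theory.
Local Open Scope ring_scope.

Section CommutingEntries.

Variable R : pzRingType.

Definition mx_entries_comm m n p q (A : 'M[R]_(m, n)) (B : 'M[R]_(p, q)) :=
  forall i j k l, GRing.comm (A i j) (B k l).

Lemma trmx_mul_comm m n p (A : 'M[R]_(m, n)) (B : 'M[R]_(n, p)) :
  mx_entries_comm A B -> (A *m B)^T = B^T *m A^T.
Proof.
move=> cAB; apply/matrixP=> i j; rewrite !mxE.
by apply: eq_bigr => k _; rewrite !mxE cAB.
Qed.

(** An entry of the left side is a sum of products a b c d, one of the right
    side a sum of products a c b d: only the two inner factors trade places. *)
Lemma tensmx_mul_comm m n p q r s (A : 'M[R]_(m, n)) (B : 'M[R]_(p, q))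
    (C : 'M[R]_(n, r)) (D : 'M[R]_(q, s)) :
  mx_entries_comm B C -> (A *t B) *m (C *t D) = (A *m C) *t (B *m D).
Proof.
move=> cBC; apply/matrixP=> i j.
case: (mxtens_indexP i) => i0 i1; case: (mxtens_indexP j) => j0 j1.
rewrite tensmxE !mxE mulr_sum; apply: eq_bigr => k _.
by rewrite !mxE !mxtens_indexK /= -!mulrA; congr (_ * _); rewrite !mulrA cBC.
Qed.

Lemma ntensmx_entries_comm m n p q (A : 'M[R]_(m, n)) (B : 'M[R]_(p, q)) k :
  mx_entries_comm A B -> mx_entries_comm (A ^t k) B.
Proof.
move=> cAB; case: k => [|k].
  by move=> i j a b; rewrite !mxE; apply/commr_sym/commrMn/commr1.
rewrite /ntensmx; elim: k => [|k IHk] //= i j a b.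
by rewrite mxE; apply/commr_sym/commrM; apply: commr_sym.
Qed.

Lemma ntensmx_mul_comm m n p (A : 'M[R]_(m, n)) (B : 'M[R]_(n, p)) k :
  mx_entries_comm A B -> (A *m B) ^t k = A ^t k *m B ^t k.
Proof.
move=> cAB; case: k => [|k]; first by rewrite !ntensmx0 mul1mx.
elim: k => [|k IHk] //; rewrite !ntensmxSS IHk tensmx_mul_comm //.
exact: (ntensmx_entries_comm (k := k.+1) cAB).
Qed.

Lemma trmx_ntens m n (A : 'M[R]_(m, n)) k : (A ^t k)^T = A^T ^t k.
Proof.
case: k => [|k]; first by rewrite !ntensmx0 trmx1.
by elim: k => [|k IHk] //; rewrite !ntensmxSS trmx_tens IHk.
Qed.

End CommutingEntries.

Lemma map_ntensmx (R S : pzRingType) (f : {rmorphism R -> S}) m n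
    (A : 'M[R]_(m, n)) k :
  map_mx f (A ^t k) = map_mx f A ^t k.
Proof.
case: k => [|k]; first by rewrite !ntensmx0 map_mx1.
by elim: k => [|k IHk] //; rewrite !ntensmxSS map_mxT IHk.
Qed.

Lemma ntensmx_unit (F : fieldType) m (A : 'M[F]_m) k :
  m != 0%N -> A \in unitmx -> A ^t k \in unitmx.
Proof.
move=> m0 uA; case: k => [|k]; first exact: unitmx1.
elim: k => [|k IHk] //; rewrite ntensmxSS.
by apply: (@tensmx_unit _ m (m ^ k.+1)); rewrite // expn_eq0 (negPf m0).
Qed.

Section Blocks.

Variables (F : fieldType) (m : nat).

(** The proof of invertibility is an argument so that the function can carry a
    structure of ring morphism. *)
Definition block_conj (g : 'M[F]_m) (ug : g \in unitmx) (X : 'M[F]_m) :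
    'M[F]_m :=
  g *m X *m invmx g.

Section BlockConj.

Variables (g : 'M[F]_m) (ug : g \in unitmx).

Fact block_conj_zmod_morphism : zmod_morphism (block_conj ug).
Proof. by move=> X Y; rewrite /block_conj mulmxBr mulmxBl. Qed.

HB.instance Definition _ :=
  GRing.isZmodMorphism.Build 'M[F]_m 'M[F]_m (block_conj ug)
    block_conj_zmod_morphism.

Fact block_conj_monoid_morphism : monoid_morphism (block_conj ug).
Proof.
split=> [|X Y]; rewrite /block_conj; first by rewrite mulmx1 mulmxV.
by rewrite -!mulmxE -!mulmxA (mulmxA (invmx g)) mulVmx // mul1mx !mulmxA.
Qed.

HB.instance Definition _ :=
  GRing.isMonoidMorphism.Build 'M[F]_m 'M[F]_m (block_conj ug)
    block_conj_monoid_morphism.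

Lemma block_trace_conj p q (M : 'M['M[F]_m]_(p, q)) :
  block_trace (map_mx (block_conj ug) M) = block_trace M.
Proof.
apply/matrixP=> i j; rewrite !mxE /block_conj mxtrace_mulC mulmxA mulVmx //.
by rewrite mul1mx.
Qed.

End BlockConj.

Definition scalar_blocks p q (P : 'M[F]_(p, q)) : 'M['M[F]_m]_(p, q) :=
  map_mx (@scalar_mx F m) P.

Lemma scalar_blocks_comm p q r s (P : 'M[F]_(p, q)) (M : 'M['M[F]_m]_(r, s)) :
  mx_entries_comm (scalar_blocks P) M.
Proof. by move=> i j k l; rewrite mxE; apply/esym/scalar_mxC. Qed.

Lemma block_trace_mul_scalarl p q r (P : 'M[F]_(p, q))
    (M : 'M['M[F]_m]_(q, r)) :
  block_trace (scalar_blocks P *m M) = P *m block_trace M.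
Proof.
apply/matrixP=> i j; rewrite !mxE raddf_sum; apply: eq_bigr => k _.
by rewrite !mxE -mulmxE mul_scalar_mx /= mxtraceZ.
Qed.

Lemma block_trace_mul_scalarr p q r (M : 'M['M[F]_m]_(p, q))
    (P : 'M[F]_(q, r)) :
  block_trace (M *m scalar_blocks P) = block_trace M *m P.
Proof.
apply/matrixP=> i j; rewrite !mxE raddf_sum; apply: eq_bigr => k _.
by rewrite !mxE -mulmxE mul_mx_scalar /= mxtraceZ mulrC.
Qed.

Lemma mulmx_alg_block (g : 'M[F]_m) (A : 'M[F]_(m, m * m)) j :
  g *m alg_block A j = alg_block (g *m A) j.
Proof.
by apply/matrixP=> i k; rewrite !mxE; apply: eq_bigr => a _; rewrite mxE.
Qed.

(** In [gA(h (x) h)] the left leg of the tensor product mixes the blocks; the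
    right leg, together with [g], conjugates each of them. *)
Lemma alg_row_action (g : 'M[F]_m) (ug : g \in unitmx) (A : 'M[F]_(m, m * m)) :
  alg_row (alg_action g A) =
    map_mx (block_conj ug) (alg_row A *m scalar_blocks (invmx g)).
Proof.
apply/matrixP=> i0 j; rewrite !mxE rmorph_sum /=; apply/matrixP=> i k.
rewrite summxE /alg_action mxE [LHS]mxE.
transitivity (\sum_a \sum_b
    (g *m A) i (mxtens_index (a, b)) * (invmx g a j * invmx g b k)).
  rewrite pair_big (reindex (@mxtens_index m m)) /=.
    by apply: eq_bigr => -[a b] _; rewrite tensmxE.
  by exists (@mxtens_unindex m m) => c _; rewrite ?mxtens_indexK ?mxtens_unindexK.
apply: eq_bigr => a _; rewrite !mxE; apply: eq_bigr => b _.
rewrite mxE -mulmxE mul_mx_scalar -scalemxAr mulmx_alg_block !mxE.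
by rewrite mulrCA mulrA.
Qed.

Lemma alg_gram_action (g : 'M[F]_m) (ug : g \in unitmx)
    (A : 'M[F]_(m, m * m)) :
  alg_gram (alg_action g A) =
    map_mx (block_conj ug)
      ((scalar_blocks (invmx g))^T *m alg_gram A *m scalar_blocks (invmx g)).
Proof.
rewrite /alg_gram (alg_row_action ug) map_trmx -map_mxM trmx_mul_comm.
  by rewrite !mulmxA.
by move=> i j k l; apply/commr_sym/scalar_blocks_comm.
Qed.

(** Once the conjugation is gone, the two outer factors consist of scalar
    blocks and leave the trace as matrices over [F]. *)
Lemma alg_form_mx_action (g : 'M[F]_m) (A : 'M[F]_(m, m * m)) k :
  g \in unitmx ->
  alg_form_mx (alg_action g A) k =
    (invmx g ^t k)^T *m alg_form_mx A k *m (invmx g ^t k).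
Proof.
move=> ug; rewrite /alg_form_mx (alg_gram_action ug) -map_ntensmx.
rewrite block_trace_conj ntensmx_mul_comm; last first.
  by move=> i j a b; apply/commr_sym/scalar_blocks_comm.
rewrite map_trmx ntensmx_mul_comm; last exact: scalar_blocks_comm.
rewrite /scalar_blocks -!map_ntensmx block_trace_mul_scalarr.
by rewrite block_trace_mul_scalarl trmx_ntens.
Qed.

End Blocks.

(** Equality of the bundled forms, which contain proofs, needs both
    extensionality of functions and irrelevance of proofs. *)
Lemma qf_comp_of_mx (F : fieldType) n (Q h : 'M[F]_n) :
  qf_comp (qf_of_mx Q) h = qf_of_mx (h^T *m Q *m h).
Proof.
have fun_eq : qf_fun (qf_comp (qf_of_mx Q) h) = mx_qf (h^T *m Q *m h).
  by apply/funext => x; rewrite /= /mx_qf trmx_mul !mulmxA.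
move: (qf_comp _ _) fun_eq => [q qP] /= fun_eq.
by case: _ / (esym fun_eq) in qP *; congr QuadraticForm; apply: Prop_irrelevance.
Qed.

Theorem theorem1 (F : fieldType) (hF : 2%N \notin [pchar F])
    (m k : nat) (hm : (1 <= m)%N) (hk : (1 <= k)%N)
    (f : quadratic_form F (m ^ k) -> F) (hf : qf_invariant f) :
  alg_invariant (fun A : 'M[F]_(m, m * m) => f (alg_qf k A)).
Proof.
move=> g A ug; rewrite /alg_qf alg_form_mx_action // -qf_comp_of_mx.
by apply: hf; apply: ntensmx_unit; rewrite -?lt0n // unitmx_inv.
Qed.
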